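(* Let $G$ be a simple graph. Then the following statements are equivalent: (i) $G$ does not contain any isolated vertices. (ii) There are a semimetric $d$ on $V(G)$ and disjoint nonempty sets $A, B \subseteq V(G)$ such that $G$ is a path-proximinal graph for $A$ and $B$ with respect to $d$. (iii) There are a metric $d$ on $V(G)$ and disjoint nonempty sets $A, B \subseteq V(G)$ such that $G$ is a path-proximinal graph for $A$ and $B$ with respect to $d$.
   Context: Graphs are simple (no loops, no multiple edges), have a nonempty vertex set $V(G)$ and edge set $E(G)$, and may be infinite. A vertex is isolated if it is adjacent to no vertex. A semimetric on a nonempty set $X$ is a function $d\colon X\times X\to[0,\infty)$ with $d(x,y)=d(y,x)$ and $d(x,y)=0\Leftrightarrow x=y$ for all $x,y\in X$; it is a metric if it also satisfies the triangle inequality. A nonempty subset $A$ of a semimetric space $(X,d)$ is proximinal if for every $x\in X$ there is $a_0\in A$ with $d(x,a_0)=\inf\{d(x,a)\colon a\in A\}$. For nonempty $A,B\subseteq X$, $\operatorname{dist}(A,B):=\inf\{d(a,b)\colon a\in A,\ b\in B\}$. A path is a finite graph $P$ whose (distinct) vertices can be numbered $u_0,\dots,u_k$, $k\ge 1$, so that $E(P)=\{\{u_0,u_1\},\dots,\{u_{k-1},u_k\}\}$. Let $A,B$ be nonempty disjoint sets. A path $P$ is a be-path of $A$ and $B$ if $V(P)\subseteq A\cup B$ and there is exactly one edge $\{a_0,b_0\}\in E(P)$ meeting both $A$ and $B$. A graph $G$ is a path-bipartite graph of $A$ and $B$ if $A,B\subseteq V(G)$ and $G$ is the union (of vertex sets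 and of edge sets) of a nonempty set of be-paths of $A$ and $B$. Let $G$ be a path-bipartite graph of $A$ and $B$, and let $d$ be a semimetric on $X:=A\cup B=V(G)$. The graph $G$ is path-proximinal for $A$ and $B$ with respect to $d$ if $A$ and $B$ are proximinal subsets of $(X,d)$ and, for all distinct $x,y\in X$, $\{x,y\}\in E(G)\Leftrightarrow d(x,y)\le\operatorname{dist}(A,B)$. *)

(* Defs.v *)
From HB Require Import structures.
From mathcomp Require Import all_boot all_order all_algebra.
From mathcomp Require Import boolp classical_sets functions cardinality reals.

Set Implicit Arguments.
Unset Strict Implicit.
Unset Printing Implicit Defensive.

Import Order.TTheory GRing.Theory Num.Theory.

Local Open Scope classical_set_scope.
Local Open Scope ring_scope.

(* Vertices live in an ambient type [U], so that a graph and the paths it is the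
   union of are objects of the same type.  Edges are unordered pairs of vertices,
   i.e. two-element sets. *)
Record graph (U : Type) := Graph {
  vset : set U;
  edges : set (set U);
  vset_nonempty : vset !=set0;
  edges_pair : forall e, edges e ->
    exists x y, [/\ vset x, vset y, x <> y & e = [set x; y]]
}.

Definition adjacent (U : Type) (G : graph U) (x y : U) : Prop :=
  edges G [set x; y].

Definition isolated (U : Type) (G : graph U) (x : U) : Prop :=
  vset G x /\ ~ (exists y, adjacent G x y).

Definition is_path (U : Type) (P : graph U) : Prop :=
  exists (k : nat) (u : nat -> U),
    [/\ (1 <= k)%N,
        (forall i j, (i <= k)%N -> (j <= k)%N -> u i = u j -> i = j),
        vset P = [set u i | i in [set i | (i <= k)%N]] &
        edges P = [set [set u i; u i.+1] | i in [set i | (i < k)%N]]].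

Definition be_path (U : Type) (A B : set U) (P : graph U) : Prop :=
  [/\ is_path P,
      vset P `<=` A `|` B &
      exists! e : set U,
        [/\ edges P e, e `&` A !=set0 & e `&` B !=set0]].

Definition path_bipartite (U : Type) (A B : set U) (G : graph U) : Prop :=
  [/\ A `<=` vset G, B `<=` vset G &
      exists F : set (graph U),
        [/\ F !=set0,
            (forall P, F P -> be_path A B P),
            vset G = \bigcup_(P in F) vset P &
            edges G = \bigcup_(P in F) edges P]].

Lemma path_bipartite_vset (U : Type) (A B : set U) (G : graph U) :
  path_bipartite A B G -> A `|` B = vset G.
Proof.
move=> [AG BG [F [_ FP VG _]]]; apply/seteqP; split; first by move=> x [/AG|/BG].
by rewrite VG => x [P /FP [_ PAB _] /PAB].
Qed.

(* A distance on a set [X] is a function on the ambient type; only its values on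
   [X * X] matter. *)
Definition is_semimetric (R : realType) (U : Type) (X : set U)
    (d : U -> U -> R) : Prop :=
  forall x y, X x -> X y ->
    [/\ 0 <= d x y, d x y = d y x & (d x y = 0 <-> x = y)].

Definition is_metric (R : realType) (U : Type) (X : set U)
    (d : U -> U -> R) : Prop :=
  is_semimetric X d /\
  (forall x y z, X x -> X y -> X z -> d x z <= d x y + d y z).

Definition proximinal (R : realType) (U : Type) (X : set U)
    (d : U -> U -> R) (A : set U) : Prop :=
  [/\ A !=set0, A `<=` X &
      forall x, X x -> exists2 a0, A a0 & d x a0 = inf [set d x a | a in A]].

Definition dist (R : realType) (U : Type) (d : U -> U -> R) (A B : set U) : R :=
  inf [set d a b | a in A & b in B].

(* [vset G] is [A `|` B] here, by [path_bipartite_vset]. *)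
Definition path_proximinal (R : realType) (U : Type) (A B : set U)
    (G : graph U) (d : U -> U -> R) : Prop :=
  [/\ path_bipartite A B G,
      proximinal (vset G) d A,
      proximinal (vset G) d B &
      forall x y, vset G x -> vset G y -> x <> y ->
        (edges G [set x; y] <-> d x y <= dist d A B)].

(* Main.v *)
(* Take a maximal independent set [A] (by Zorn's lemma) and let [B] be its
   complement.  No edge lies inside [A] and every vertex of [B] has a neighbour
   in [A], so an edge inside [B] extends to a be-path of two edges, while an edge
   between [A] and [B] is a be-path by itself; without isolated vertices, these
   paths cover [G].  The metric is the graph distance truncated at 2: it takes
   values in {0, 1, 2}, so infima are attained, and dist(A, B) = 1. *)
Require Import Defs.
From HB Require Import structures.
From mathcomp Require Import all_boot all_order all_algebra.
From mathcomp Require Import boolp classical_sets functions cardinality reals.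

Set Implicit Arguments.
Unset Strict Implicit.
Unset Printing Implicit Defensive.

Import Order.TTheory GRing.Theory Num.Theory.

Local Open Scope classical_set_scope.
Local Open Scope ring_scope.

(** * Edges, and paths as graphs *)

Lemma edges_neq (U : Type) (G : graph U) (x y : U) :
  edges G [set x; y] -> [/\ vset G x, vset G y & x <> y].
Proof.
move=> /edges_pair[z [w [Gz Gw zw e]]].
have G2 t : [set x; y] t -> vset G t by rewrite e => -[] ->.
split; [by apply: G2; left|by apply: G2; right|] => xy; apply: zw.
(* If [x = y], then [z] and [w] both lie in a singleton and coincide. *)
have: [set x; y] z by rewrite e; left.
have: [set x; y] w by rewrite e; right.
by rewrite xy => -[] -> [] ->.
Qed.

(** Injectivity of [u] up to [k] makes consecutive vertices distinct, as the field [edges_pair]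
    demands of every edge. *)
Lemma is_path_graph (U : Type) (k : nat) (u : nat -> U) : (1 <= k)%N ->
    (forall i j, (i <= k)%N -> (j <= k)%N -> u i = u j -> i = j) ->
  exists P, [/\ is_path P, vset P = [set u i | i in [set i | (i <= k)%N]] &
    edges P = [set [set u i; u i.+1] | i in [set i | (i < k)%N]]].
Proof.
move=> k1 uI; set V := [set u i | i in _].
set E := [set [set u i; u i.+1] | i in _].
have V0 : V !=set0 by exists (u 0%N), 0%N.
have EV e : E e -> exists x y, [/\ V x, V y, x <> y & e = [set x; y]].
  move=> [i /= ik <-]; exists (u i), (u i.+1); split => //.
  - by exists i => //; exact: ltnW.
  - by exists i.+1.
  - by move=> /(uI _ _ (ltnW ik) ik)/eqP; rewrite -{1}[i]addn0 -addn1 eqn_add2l.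
by exists (Graph V0 EV); split => //; exists k, u.
Qed.

Lemma disjoint_neq (U : Type) (A B : set U) (x y : U) :
  A `&` B = set0 -> A x -> B y -> x <> y.
Proof.
move=> AB0 Ax By xy; suff : (A `&` B) x by rewrite AB0.
by split; rewrite // xy.
Qed.

(** * Be-paths with one or two edges *)

Section BePath.
Variables (U : Type) (A B : set U).
Hypothesis AB0 : A `&` B = set0.

Lemma be_path_crossing_edge (a b : U) : A a -> B b ->
  exists P, [/\ be_path A B P, vset P = [set a; b] & edges P = [set [set a; b]]].
Proof.
(* Only the indices 0 and 1 matter; [u] repeats [b] outside the range where injectivity is asked. *)
move=> Aa Bb; pose u i := if i is 0%N then a else b.
have [||P [Pp VP EP]] := @is_path_graph _ 1 u.
- by [].
- by have ab := disjoint_neq AB0 Aa Bb; move=> [|[|i]] [|[|j]] //= _ _ /esym.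
have {}VP : vset P = [set a; b].
  rewrite VP; apply/seteqP; split => [_ [[|i] _ <-]|x [] ->]; [by left|by right| |].
    by exists 0%N.
  by exists 1%N.
have {}EP : edges P = [set [set a; b]].
  rewrite EP; apply/seteqP; split => [_ [[|i] //= _ <-] //|e /= ->]; by exists 0%N.
exists P; split => //; split => //; first by rewrite VP => x [] ->; [left|right].
exists [set a; b]; rewrite EP; split => [|e [->//]].
by split => //; [exists a; split => //; left|exists b; split => //; right].
Qed.

(** Both [b] and [c] lie in [B], disjoint from [A], so the edge between them misses [A] and the
    first edge is the only crossing one. *)
Lemma be_path_two_edges (a b c : U) : A a -> B b -> B c -> b <> c ->
  exists P, [/\ be_path A B P, vset P = [set x | [\/ x = a, x = b | x = c]] &
    edges P = [set [set a; b]; [set b; c]]].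
Proof.
move=> Aa Bb Bc bc; pose u i := if i is i'.+1 then if i' is 0%N then b else c else a.
have ab := disjoint_neq AB0 Aa Bb.
have ac := disjoint_neq AB0 Aa Bc.
have [||P [Pp VP EP]] := @is_path_graph _ 2 u.
- by [].
- by move=> [|[|[|i]]] [|[|[|j]]] //= _ _ /esym // /esym.
have {}VP : vset P = [set x | [\/ x = a, x = b | x = c]].
  rewrite VP; apply/seteqP; split => [_ [[|[|i]] _ <-]|x /= []->] /=.
  - exact: Or31.
  - exact: Or32.
  - exact: Or33.
  - by exists 0%N.
  - by exists 1%N.
  - by exists 2%N.
have {}EP : edges P = [set [set a; b]; [set b; c]].
  rewrite EP; apply/seteqP; split => [_ [[|[|i]] //= _ <-]|e /= []->].
  - by left.
  - by right.
  - by exists 0%N.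
  - by exists 1%N.
exists P; split => //; split => //.
  by rewrite VP => x /= [] ->; [left|right|right].
exists [set a; b]; rewrite EP; split; first split.
- by left.
- by exists a; split => //; left.
- by exists b; split => //; right.
- move=> e [[//|->] [x [xbc Ax] _]].
  by case: xbc => xE; [case: (disjoint_neq AB0 Ax Bb)|case: (disjoint_neq AB0 Ax Bc)].
Qed.

End BePath.

(** * Isolated vertices and path-bipartite graphs *)

Lemma path_bipartite_nonisolated (U : Type) (A B : set U) (G : graph U) :
  path_bipartite A B G -> ~ exists x, isolated G x.
Proof.
move=> [_ _ [F [_ FP VG EG]]] [x []]; rewrite VG => -[P FP' Px]; apply.
move: (FP _ FP') => [[k [u [k1 _ VP EP]]] _ _].
suff [y xy] : exists y, edges P [set x; y].
  by exists y; rewrite /adjacent EG; exists P.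
(* The start of the path has a successor because [1 <= k]; any other vertex has a predecessor. *)
move: Px; rewrite VP => -[[|i] /= ik <-].
  by exists (u 1%N); rewrite EP; exists 0%N.
by exists (u i); rewrite EP setUC; exists i.
Qed.

(** Independence passes to unions of chains, since two vertices of the union already lie in one
    member of the chain. *)
Lemma exists_maximal_independent_set (U : Type) (G : graph U) :
  exists A : set U, [/\ A `<=` vset G,
    (forall x y, A x -> A y -> ~ adjacent G x y) &
    forall x, vset G x -> ~ A x -> exists2 y, A y & adjacent G x y].
Proof.
pose P (A : set U) := A `<=` vset G /\ forall x y, A x -> A y -> ~ adjacent G x y.
have [|A [[AG Aind] Amax]] := @Zorn_bigcup U P.
  move=> F FP Ftot; split; first by move=> x [X /FP[XG _]] /XG.
  move=> x y [X FX Xx] [Y FY Yy].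
  have [XY|YX] := Ftot _ _ FX FY; first by have [_] := FP _ FY; apply => //; apply: XY.
  by have [_] := FP _ FX; apply => //; apply: YX.
exists A; split => // x Gx nAx; apply: contrapT => nadj.
have nadjA y : A y -> ~ adjacent G x y by move=> Ay xy; apply: nadj; exists y.
(* Without a neighbour of [x] in [A], adding [x] would preserve independence, against maximality. *)
apply: (Amax (x |` A)).
  by split => [y Ay|/(_ x) xA]; [right|apply: nAx; apply: xA; left].
split; first by move=> y [->//|/AG].
move=> y z [->|Ay] [->|Az].
- by move=> xx; have [_ _] := edges_neq xx.
- exact: nadjA.
- by rewrite /adjacent setUC; exact: nadjA.
- exact: Aind.
Qed.

Lemma exists_path_bipartite (U : Type) (G : graph U) :
    ~ (exists x, isolated G x) ->
  exists A B : set U, [/\ A `&` B = set0, path_bipartite A B G &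
    exists a b, [/\ A a, B b & adjacent G a b]].
Proof.
move=> niso; have [A [AG Aind Amax]] := exists_maximal_independent_set G.
pose B := vset G `\` A.
have nbr x : vset G x -> exists y, adjacent G x y.
  by move=> Gx; apply: contrapT => nx; apply: niso; exists x.
have AB0 : A `&` B = set0 by apply/seteqP; split => // x [Ax [_]].
have nbrA x y : A x -> adjacent G x y -> B y.
  by move=> Ax xy; have [_ Gy _] := edges_neq xy; split => // Ay; exact: Aind xy.
(* Taking all be-paths that are subgraphs of [G] makes their union lie in [G]; it remains to see
   that they cover [G]. *)
pose F : set (graph U) := [set P | [/\ be_path A B P, vset P `<=` vset G &
  edges P `<=` edges G]].
(* The clause [vset P x] lets the cover of the edges also cover the vertices, each being an endpoint
   of some edge. *)
have Fedge x y : adjacent G x y -> exists P, [/\ F P, vset P x & edges P [set x; y]].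
  move=> xy; have [Gx Gy xNy] := edges_neq xy.
  have crossing a b : A a -> adjacent G a b ->
      exists P, [/\ F P, vset P = [set a; b] & edges P [set a; b]].
    move=> Aa ab; have [Ga Gb _] := edges_neq ab.
    have [P [beP VP EP]] := be_path_crossing_edge AB0 Aa (nbrA _ _ Aa ab).
    exists P; rewrite EP; split => //; split => //; first by rewrite VP => t [] ->.
    by rewrite EP => _ ->.
  have [Ax|nAx] := pselect (A x).
    have [P [FP VP EP]] := crossing _ _ Ax xy.
    by exists P; rewrite VP; split => //; left.
  have [Ay|nAy] := pselect (A y).
    move: xy; rewrite /adjacent setUC => /(crossing _ _ Ay)[P [FP VP EP]].
    by exists P; rewrite VP; split => //; right.
  (* Both endpoints are in [B]: a neighbour [a] of [x] in [A] is put in front, giving the path [a],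
     [x], [y]. *)
  have [a Aa ax] := Amax _ Gx nAx.
  have {}ax : adjacent G a x by rewrite /adjacent setUC.
  have [P [beP VP EP]] :=
    be_path_two_edges AB0 Aa (conj Gx nAx : B x) (conj Gy nAy : B y) xNy.
  exists P; split; [split => //| |by rewrite EP; right].
  - by rewrite VP => t /= [] -> //; exact: AG.
  - by rewrite EP => t [] ->.
  - by rewrite VP; exact: Or32.
have [v Gv] := vset_nonempty G.
exists A, B; split => //.
- split => //; first by move=> x [].
  exists F; split.
  + by have [w /Fedge[P [FP _ _]]] := nbr _ Gv; exists P.
  + by move=> P [].
  + apply/seteqP; split => [x Gx|x [P [_ PG _] /PG //]].
    by have [y /Fedge[P [FP Px _]]] := nbr _ Gx; exists P.
  + apply/seteqP; split => [e Ge|e [P [_ _ PG] /PG //]].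
    have [x [y [_ _ _ exy]]] := edges_pair Ge.
    have [|P [FP _ Pe]] := Fedge x y; first by rewrite /adjacent -exy.
    by exists P; rewrite ?exy.
- have [a Aa] : A !=set0.
    by have [Av|/(Amax _ Gv)[a Aa _]] := pselect (A v); [exists v|exists a].
  have [b ab] := nbr _ (AG _ Aa).
  by exists a, b; split => //; exact: nbrA ab.
Qed.

(** * Attained infima and the truncated distance *)

Lemma inf_minimum (R : realType) (S : set R) (m : R) : S m -> lbound S m -> inf S = m.
Proof.
move=> Sm mS; apply/eqP; rewrite eq_le; apply/andP; split.
  by apply: ge_inf => //; exists m.
by apply: lb_le_inf => //; exists m.
Qed.

(** Well-ordering of the natural numbers gives a least value, even when [A] is infinite. *)
Lemma inf_natr_attained (R : realType) (T : Type) (A : set T) (f : T -> nat) :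
  A !=set0 -> exists2 a, A a & (f a)%:R = inf [set (f x)%:R | x in A] :> R.
Proof.
move=> [a0 Aa0]; have ex : exists n, `[< exists2 a, A a & f a = n >].
  by exists (f a0); apply/asboolP; exists a0.
case: (ex_minnP ex) => n /asboolP[a Aa <-] amin; exists a => //.
apply/esym/inf_minimum; first by exists a.
by move=> _ [x Ax <-]; rewrite ler_nat; apply: amin; apply/asboolP; exists x.
Qed.

(** The value 2 also serves for vertices in different components. Values are kept in [nat] so that
    well-ordering yields proximinality. *)
Definition truncated_dist (U : Type) (G : graph U) (x y : U) : nat :=
  if `[< x = y >] then 0%N else if `[< adjacent G x y >] then 1%N else 2%N.

Section TruncatedDist.
Variables (R : realType) (U : Type) (G : graph U).

Let d (x y : U) : R := (truncated_dist G x y)%:R.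

Lemma truncated_dist_le1 (x y : U) : x <> y ->
  (truncated_dist G x y <= 1)%N <-> adjacent G x y.
Proof.
by rewrite /truncated_dist => ?; case: asboolP => // _; case: asboolP.
Qed.

Lemma truncated_dist_gt0 (x y : U) : x <> y -> (0 < truncated_dist G x y)%N.
Proof. by rewrite /truncated_dist; case: asboolP => // _; case: ifP. Qed.

Lemma truncated_dist_metric : is_metric (vset G) d.
Proof.
rewrite /d /truncated_dist; split => [x y _ _|x y z _ _ _].
  have -> : (y = x) = (x = y) by apply/propext; split.
  rewrite ler0n /adjacent [[set y; x]]setUC; split => //.
  case: asboolP => // xy; split => //; case: ifP => _ /eqP.
    by rewrite oner_eq0.
  by rewrite pnatr_eq0.
rewrite -natrD ler_nat.
(* If [x = y] or [y = z], both sides agree; otherwise the right side is at least 1 + 1, the largest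
   value the left can take. *)
case: (asboolP (x = y)) => [->//|xy]; case: (asboolP (y = z)) => [->|yz].
  by rewrite addn0; case: asboolP xy.
by case: asboolP => // _; do 3 case: ifP => _.
Qed.

Lemma truncated_dist_path_proximinal (A B : set U) : A `&` B = set0 ->
    path_bipartite A B G -> (exists a b, [/\ A a, B b & adjacent G a b]) ->
  path_proximinal A B G d.
Proof.
move=> AB0 bip [a [b [Aa Bb ab]]]; have [AG BG _] := bip.
have prox C : C `<=` vset G -> C !=set0 -> proximinal (vset G) d C.
  move=> CG C0; split => // x _.
  exact: inf_natr_attained.
split => //; [by apply: prox => //; exists a|by apply: prox => //; exists b|].
(* Disjointness keeps distances between [A] and [B] at least 1, and the edge from [a] to [b] attains
   this bound. *)
have -> : dist d A B = 1.
  apply: inf_minimum.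
    exists a => //; exists b => //; have ne := disjoint_neq AB0 Aa Bb.
    suff -> : d a b = 1%:R by [].
    congr _%:R; apply/eqP; rewrite eqn_leq truncated_dist_gt0 // andbT.
    exact/truncated_dist_le1.
  by move=> _ [x Ax [y By <-]]; rewrite ler1n truncated_dist_gt0 //; exact: disjoint_neq AB0 Ax By.
move=> x y _ _ xy; apply: iff_sym; rewrite /d -[1]/(1%:R) ler_nat.
exact: truncated_dist_le1.
Qed.

End TruncatedDist.

Theorem theorem3p7 (R : realType) (U : Type) (G : graph U) :
  [<-> (* (i) *)
       ~ (exists x, isolated G x);
       (* (ii) *)
       exists (d : U -> U -> R) (A B : set U),
         is_semimetric (vset G) d /\
         [/\ A `<=` vset G, B `<=` vset G, A !=set0, B !=set0 & A `&` B = set0] /\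
         path_proximinal A B G d;
       (* (iii) *)
       exists (d : U -> U -> R) (A B : set U),
         is_metric (vset G) d /\
         [/\ A `<=` vset G, B `<=` vset G, A !=set0, B !=set0 & A `&` B = set0] /\
         path_proximinal A B G d].
Proof.
have i_iii : ~ (exists x, isolated G x) -> exists (d : U -> U -> R) (A B : set U),
    is_metric (vset G) d /\
    [/\ A `<=` vset G, B `<=` vset G, A !=set0, B !=set0 & A `&` B = set0] /\
    path_proximinal A B G d.
  move=> /exists_path_bipartite[A [B [AB0 bip ab]]].
  exists (fun x y => (truncated_dist G x y)%:R), A, B.
  split; first exact: truncated_dist_metric.
  split; last exact: truncated_dist_path_proximinal.
  have [AG BG _] := bip; have [a [b [Aa Bb _]]] := ab.
  by split => //; [exists a|exists b].
tfae.
- by move=> /i_iii[d [A [B [[dS _] dP]]]]; exists d, A, B.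
(* The given semimetric may fail to be a metric, so the step goes through (i), and a metric is built
   afresh with new sets [A] and [B]. *)
- move=> [d [A [B [_ [_ [bip _ _ _]]]]]]; apply: i_iii.
  exact: path_bipartite_nonisolated bip.
- move=> [d [A [B [_ [_ [bip _ _ _]]]]]].
  exact: path_bipartite_nonisolated bip.
Qed.
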